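(* Let $V\subset\boldsymbol{R}^n$ be any subset and let $K$ be one of $\boldsymbol{T}[\boldsymbol{X}^{\pm}]_n/\boldsymbol{E}(V)$, $\overline{\boldsymbol{T}[\boldsymbol{X}^{\pm}]}_n/\boldsymbol{E}(V)$, $\overline{\boldsymbol{T}(\boldsymbol{X})}_n/\boldsymbol{E}(V)$. Then the canonical map $$\eta_K: K\to\Gamma(\operatorname{CSpec}(K),\mathcal{O}_{\operatorname{CSpec}(K)}),\qquad f\mapsto s_f,\quad s_f(P)=[f]\in K/P,$$ is a $\boldsymbol{T}$-algebra isomorphism.
   Context: A semiring is a commutative semiring $(S,+,\cdot)$ with absorbing additive identity $0_S$ and multiplicative identity $1_S$. A congruence on $S$ is an equivalence relation $C\subset S\times S$ compatible with addition and multiplication; it is proper if $C\neq S\times S$, and prime if it is proper and $(a\cdot c+b\cdot d,\ a\cdot d+b\cdot c)\in C$ implies $(a,b)\in C$ or $(c,d)\in C$. $\operatorname{CSpec}(S)$ is the set of prime congruences on $S$ with the Zariski topology, whose closed sets are $V(C)=\{P\in\operatorname{CSpec}(S)\mid C\subset P\}$ for $C$ a congruence on $S$. Structure sheaf: for open $U\subset\operatorname{CSpec}(S)$, $\mathcal{O}_{\operatorname{CSpec}(S)}(U)$ is the semiring (pointwise operations) of functions $s:U\to\coprod_{P\in U}S/P$ with $s(P)\in S/P$ for all $P\in U$ and such that for every $P\in U$ there exist $f\in S$ and a neighborhood $W\subset U$ of $P$ with $s(Q)=[f]\in S/Q$ for all $Q\in W$. Restriction maps are the natural ones. $\Gamma(\operatorname{CSpec}(S),\mathcal{O}_{\operatorname{CSpec}(S)})$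 denotes the semiring of global sections. If $S$ is a $\boldsymbol{T}$-algebra (a semiring with a semiring homomorphism $\boldsymbol{T}\to S$), the global sections form a $\boldsymbol{T}$-algebra via the composite $\boldsymbol{T}\to S\to\Gamma$. $\boldsymbol{T}=\boldsymbol{R}\cup\{-\infty\}$ is the tropical semifield with $a\oplus b=\max\{a,b\}$, $a\odot b=a+b$. $\boldsymbol{T}[\boldsymbol{X}^{\pm}]_n$ is the semiring of (formal) tropical Laurent polynomials in $n$ variables. $\overline{\boldsymbol{T}[\boldsymbol{X}^{\pm}]}_n$ is its quotient by the congruence of pairs $(f,g)$ with $f(x)=g(x)$ for all $x\in\boldsymbol{R}^n$; it is multiplicatively cancellative, and $\overline{\boldsymbol{T}(\boldsymbol{X})}_n$ denotes its semifield of fractions. For $L$ one of these three semirings and $V\subset\boldsymbol{R}^n$, $\boldsymbol{E}(V)=\{(f,g)\in L^2\mid f(x)=g(x)\ \forall x\in V\}$, a congruence on $L$. *)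

(* Defs.v *)
From HB Require Import structures.
From mathcomp Require Import all_boot all_order all_algebra.
From mathcomp Require Import finmap ring.
From mathcomp Require Import boolp classical_sets reals topology.

Set Implicit Arguments.
Unset Strict Implicit.
Unset Printing Implicit Defensive.

Import Order.TTheory GRing.Theory Num.Theory.
Local Open Scope ring_scope.
Local Open Scope quotient_scope.
Local Open Scope classical_set_scope.

(* Semirings are comPzSemiRingType: the zero semiring must be allowed, since
   the quotient by E(V) is the zero semiring when V is empty.  For the same
   reason the algebra structures of ssralg, which require 1 != 0, cannot be
   used for T-algebras. *)

HB.mixin Record hasStructMap (T : comPzSemiRingType) A
    of GRing.ComPzSemiRing A := {
  structmap : {rmorphism T -> A}
}.

#[short(type="semiringAlgType")]
HB.structure Definition SemiringAlg (T : comPzSemiRingType) :=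
  {A of GRing.ComPzSemiRing A & hasStructMap T A}.

Definition is_alg_iso (T : comPzSemiRingType) (A B : semiringAlgType T)
    (f : A -> B) : Prop :=
  [/\ nmod_morphism f, monoid_morphism f,
      forall t : T, f (structmap t) = structmap t & bijective f].

Section Congruences.
Variable S : comPzSemiRingType.
Implicit Types A C D : set (S * S).

Record is_congruence C : Prop := IsCongruence {
  congruence_refl : forall a, C (a, a);
  congruence_sym : forall a b, C (a, b) -> C (b, a);
  congruence_trans : forall a b c, C (a, b) -> C (b, c) -> C (a, c);
  congruence_add : forall a b c d,
    C (a, b) -> C (c, d) -> C (a + c, b + d);
  congruence_mul : forall a b c d,
    C (a, b) -> C (c, d) -> C (a * c, b * d)
}.

Definition is_prime C : Prop :=
  C <> setT /\
  forall a b c d : S, C (a * c + b * d, a * d + b * c) -> C (a, b) \/ C (c, d).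

Record congruence := Congruence {
  congruence_set :> set (S * S);
  congruenceP : is_congruence congruence_set
}.

Record CSpec := PrimeCongruence {
  cspec_congruence :> congruence;
  cspec_prime : is_prime cspec_congruence
}.

Definition zariski_closed (C : congruence) : set CSpec :=
  [set P : CSpec | (C `<=` P)].

Lemma total_is_congruence : is_congruence setT.
Proof. by split. Qed.

Definition generated A : set (S * S) :=
  [set p | forall C : congruence, (A `<=` C) -> congruence_set C p].

Lemma generated_is_congruence A : is_congruence (generated A).
Proof.
split.
- by move=> a C _; apply: congruence_refl (congruenceP C) _.
- by move=> a b h C sAC; apply: congruence_sym (congruenceP C) _ _ (h C sAC).
- move=> a b c h k C sAC.
  exact: congruence_trans (congruenceP C) _ _ _ (h C sAC) (k C sAC).
- move=> a b c d h k C sAC.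
  exact: congruence_add (congruenceP C) _ _ _ _ (h C sAC) (k C sAC).
- move=> a b c d h k C sAC.
  exact: congruence_mul (congruenceP C) _ _ _ _ (h C sAC) (k C sAC).
Qed.

Definition gen_congruence A := Congruence (generated_is_congruence A).

Lemma sub_gen A (C : congruence) :
  (gen_congruence A `<=` C) <-> (A `<=` C).
Proof.
by split=> [h p Ap|h p]; [apply: h => D; apply | apply].
Qed.

Definition zariski_open : set_system CSpec :=
  [set U | exists C : congruence, U = (~` zariski_closed C)].

Lemma zariski_openT : zariski_open setT.
Proof.
exists (Congruence total_is_congruence); apply/seteqP; split=> // P _ h.
by case: (cspec_prime P) => + _; apply; apply/seteqP; split=> // p _; apply: h.
Qed.

Lemma zariski_openI : setI_closed zariski_open.
Proof.
move=> _ _ [C ->] [D ->].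
pose A : set (S * S) := [set p | exists a b c d,
  [/\ congruence_set C (a, b), congruence_set D (c, d) & p = (a * c + b * d, a * d + b * c)]].
exists (gen_congruence A); rewrite -setCU; congr (~` _).
apply/seteqP; split=> P.
- have [rfl sm _ ad ml] := congruenceP P.
  move=> h; apply/sub_gen => p [a [b [c [d [Cab Dcd ->]]]]].
  case: h => [/(_ _ Cab)|/(_ _ Dcd)] h.
    rewrite [X in (X, _)]addrC; apply: (ad); last exact: (ml).
    by apply: (ml) => //; apply: sm.
  by apply: (ad); apply: (ml) => //; apply: sm.
- move=> /sub_gen h; apply: contrapT => /not_orP[nC nD].
  case/existsNP: nC => -[a b] /not_implyP[Cab nab].
  case/existsNP: nD => -[c d] /not_implyP[Dcd ncd].
  have [_ /(_ a b c d)] := cspec_prime P.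
  by case=> //; apply: h; exists a, b, c, d.
Qed.

Lemma zariski_open_bigU (I : Type) (f : I -> set CSpec) :
  (forall i, zariski_open (f i)) -> zariski_open (\bigcup_i f i).
Proof.
move=> /choice[C fC]; exists (gen_congruence (\bigcup_i C i)).
apply/seteqP; split=> P.
- by move=> [i _]; rewrite fC => h /sub_gen k; apply: h => p Cp; apply: k; exists i.
- move=> h; apply: contrapT => k; apply: h; apply/sub_gen => p [i _ Cp].
  apply: contrapT => nPp; apply: k; exists i => //; rewrite fC => h.
  exact/nPp/h.
Qed.

HB.instance Definition _ := gen_eqMixin CSpec.
HB.instance Definition _ := gen_choiceMixin CSpec.
HB.instance Definition _ := isOpenTopological.Build CSpec
  zariski_openT zariski_openI zariski_open_bigU.

End Congruences.

Section Quotient.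
Variables (S : comPzSemiRingType) (C : congruence S).

Definition congruence_rel : rel S := fun a b => `[< congruence_set C (a, b) >].

Lemma congruence_rel_equiv : equiv_class_of congruence_rel.
Proof.
have [rfl sm tr _ _] := congruenceP C.
split=> [a|a b|b a c].
- exact/asboolP.
- by apply/asboolP/asboolP; apply: sm.
- by move=> /asboolP h /asboolP k; apply/asboolP; apply: tr h k.
Qed.

Canonical congruence_equiv := EquivRelPack congruence_rel_equiv.

Definition squot := {eq_quot congruence_equiv}.

HB.instance Definition _ := Choice.on squot.
HB.instance Definition _ := EqQuotient.on squot.

Lemma squotP (a b : S) : \pi_squot a = \pi_squot b <-> congruence_set C (a, b).
Proof. by split=> [/eqquotP/asboolP //|h]; apply/eqquotP/asboolP. Qed.

Lemma squot_repr (a : S) : congruence_set C (repr (\pi_squot a), a).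
Proof. by apply/squotP; rewrite reprK. Qed.

Definition squot_zero : squot := \pi_squot 0.
Definition squot_one : squot := \pi_squot 1.
Definition squot_add (x y : squot) : squot := \pi_squot (repr x + repr y).
Definition squot_mul (x y : squot) : squot := \pi_squot (repr x * repr y).

Lemma squot_addE a b : squot_add (\pi_squot a) (\pi_squot b) = \pi_squot (a + b).
Proof.
by apply/squotP; apply: congruence_add (congruenceP C) _ _ _ _ _ _;
  apply: squot_repr.
Qed.

Lemma squot_mulE a b : squot_mul (\pi_squot a) (\pi_squot b) = \pi_squot (a * b).
Proof.
by apply/squotP; apply: congruence_mul (congruenceP C) _ _ _ _ _ _;
  apply: squot_repr.
Qed.

Lemma squot_addA : associative squot_add.
Proof.
by move=> x y z; elim/quotW: x => a; elim/quotW: y => b; elim/quotW: z => c;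
rewrite (squot_addE a b) (squot_addE b c) !squot_addE addrA.
Qed.
Lemma squot_addC : commutative squot_add.
Proof. by move=> x y; elim/quotW: x => a; elim/quotW: y => b; rewrite !squot_addE addrC. Qed.
Lemma squot_add0 : left_id squot_zero squot_add.
Proof. by move=> x; elim/quotW: x => a; rewrite squot_addE add0r. Qed.

HB.instance Definition _ :=
  GRing.isNmodule.Build squot squot_addA squot_addC squot_add0.

Lemma squot_mulA : associative squot_mul.
Proof.
by move=> x y z; elim/quotW: x => a; elim/quotW: y => b; elim/quotW: z => c;
rewrite (squot_mulE a b) (squot_mulE b c) !squot_mulE mulrA.
Qed.
Lemma squot_mulC : commutative squot_mul.
Proof. by move=> x y; elim/quotW: x => a; elim/quotW: y => b; rewrite !squot_mulE mulrC. Qed.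
Lemma squot_mul1 : left_id squot_one squot_mul.
Proof. by move=> x; elim/quotW: x => a; rewrite squot_mulE mul1r. Qed.
Lemma squot_mulDl : left_distributive squot_mul squot_add.
Proof.
by move=> x y z; elim/quotW: x => a; elim/quotW: y => b; elim/quotW: z => c;
rewrite (squot_addE a b) (squot_mulE a c) (squot_mulE b c) squot_mulE squot_addE mulrDl.
Qed.
Lemma squot_mul0 : left_zero squot_zero squot_mul.
Proof. by move=> x; elim/quotW: x => a; rewrite squot_mulE mul0r. Qed.

HB.instance Definition _ := GRing.Nmodule_isComPzSemiRing.Build squot
  squot_mulA squot_mulC squot_mul1 squot_mulDl squot_mul0.

Definition squot_pi (a : S) : squot := \pi_squot a.

Lemma squot_pi_nmod : nmod_morphism squot_pi.
Proof. by split=> // a b; rewrite /squot_pi -squot_addE. Qed.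
Lemma squot_pi_monoid : monoid_morphism squot_pi.
Proof. by split=> // a b; rewrite /squot_pi -squot_mulE. Qed.

HB.instance Definition _ :=
  GRing.isNmodMorphism.Build S squot squot_pi squot_pi_nmod.
HB.instance Definition _ :=
  GRing.isMonoidMorphism.Build S squot squot_pi squot_pi_monoid.

End Quotient.

HB.instance Definition _ (T : comPzSemiRingType) (S : semiringAlgType T)
    (C : congruence S) :=
  hasStructMap.Build T (squot C)
    (squot_pi C \o (structmap : {rmorphism T -> S})).

Record open_set (X : topologicalType) := OpenSet {
  open_set_set :> set X;
  open_setP : open open_set_set
}.

Definition open_setT (X : topologicalType) : open_set X := OpenSet openT.

Section StructureSheaf.
Variables (S : comPzSemiRingType) (U : open_set (CSpec S)).

Definition locally_induced (s : forall P : U, squot (val P)) : Prop :=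
  forall P : U, exists (f : S) (W : set (CSpec S)),
    [/\ nbhs (val P) W, (W `<=` U) &
        forall Q : U, W (val Q) -> s Q = squot_pi (val Q) f].

Record structure_sheaf := SheafSection {
  section_val :> forall P : U, squot (val P);
  sectionP : locally_induced section_val
}.

HB.instance Definition _ := gen_eqMixin structure_sheaf.
HB.instance Definition _ := gen_choiceMixin structure_sheaf.

Lemma section_eq (s t : structure_sheaf) : (forall P, s P = t P) -> s = t.
Proof.
case: s t => [s hs] [t ht] /= st.
have {}st : s = t by apply: functional_extensionality_dep.
by case: _ / st in ht *; congr SheafSection; apply: Prop_irrelevance.
Qed.

Lemma canonical_induced (f : S) :
  locally_induced (fun P : U => squot_pi (val P) f).
Proof.
move=> P; exists f, U; split=> //; apply: open_nbhs_nbhs.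
by split; [exact: open_setP | exact: set_valP].
Qed.

Lemma add_induced (s t : structure_sheaf) : locally_induced (fun P => s P + t P).
Proof.
move=> P; have [f [V [PV VU sV]]] := sectionP s P.
have [g [W [PW WU tW]]] := sectionP t P.
exists (f + g), (V `&` W); split; first exact: filterI.
  by move=> Q [] /VU.
by move=> Q [/sV -> /tW ->]; rewrite rmorphD.
Qed.

Lemma mul_induced (s t : structure_sheaf) : locally_induced (fun P => s P * t P).
Proof.
move=> P; have [f [V [PV VU sV]]] := sectionP s P.
have [g [W [PW WU tW]]] := sectionP t P.
exists (f * g), (V `&` W); split; first exact: filterI.
  by move=> Q [] /VU.
by move=> Q [/sV -> /tW ->]; rewrite rmorphM.
Qed.

Definition canonical_section (f : S) : structure_sheaf := SheafSection (canonical_induced f).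
Definition section_add (s t : structure_sheaf) : structure_sheaf := SheafSection (add_induced s t).
Definition section_mul (s t : structure_sheaf) : structure_sheaf := SheafSection (mul_induced s t).

Lemma section_addA : associative section_add.
Proof. by move=> s t u; apply: section_eq => P /=; rewrite addrA. Qed.
Lemma section_addC : commutative section_add.
Proof. by move=> s t; apply: section_eq => P /=; rewrite addrC. Qed.
Lemma section_add0 : left_id (canonical_section 0) section_add.
Proof. by move=> s; apply: section_eq => P /=; rewrite rmorph0 add0r. Qed.

HB.instance Definition _ :=
  GRing.isNmodule.Build structure_sheaf section_addA section_addC section_add0.

Lemma section_mulA : associative section_mul.
Proof. by move=> s t u; apply: section_eq => P /=; rewrite mulrA. Qed.
Lemma section_mulC : commutative section_mul.
Proof. by move=> s t; apply: section_eq => P /=; rewrite mulrC. Qed.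
Lemma section_mul1 : left_id (canonical_section 1) section_mul.
Proof. by move=> s; apply: section_eq => P /=; rewrite rmorph1 mul1r. Qed.
Lemma section_mulDl : left_distributive section_mul section_add.
Proof. by move=> s t u; apply: section_eq => P /=; rewrite mulrDl. Qed.
Lemma section_mul0 : left_zero (canonical_section 0) section_mul.
Proof. by move=> s; apply: section_eq => P /=; rewrite rmorph0 mul0r. Qed.

HB.instance Definition _ := GRing.Nmodule_isComPzSemiRing.Build structure_sheaf
  section_mulA section_mulC section_mul1 section_mulDl section_mul0.

Lemma canonical_section_nmod : nmod_morphism canonical_section.
Proof. by split=> // f g; apply: section_eq => P /=; rewrite rmorphD. Qed.
Lemma canonical_section_monoid : monoid_morphism canonical_section.
Proof. by split=> // f g; apply: section_eq => P /=; rewrite rmorphM. Qed.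

HB.instance Definition _ :=
  GRing.isNmodMorphism.Build S structure_sheaf canonical_section canonical_section_nmod.
HB.instance Definition _ :=
  GRing.isMonoidMorphism.Build S structure_sheaf canonical_section canonical_section_monoid.

End StructureSheaf.

HB.instance Definition _ (T : comPzSemiRingType) (S : semiringAlgType T)
    (U : open_set (CSpec S)) :=
  hasStructMap.Build T (structure_sheaf U)
    (canonical_section U \o (structmap : {rmorphism T -> S})).

Definition global_sections (S : comPzSemiRingType) := structure_sheaf (open_setT (CSpec S)).

HB.instance Definition _ (S : comPzSemiRingType) :=
  GRing.ComPzSemiRing.on (global_sections S).
HB.instance Definition _ (T : comPzSemiRingType) (S : semiringAlgType T) :=
  SemiringAlg.on (global_sections S).

Definition eta (S : comPzSemiRingType) : S -> global_sections S :=
  canonical_section (open_setT (CSpec S)).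

(* None is -oo, the semiring addition is the maximum and the semiring
   multiplication is the addition of reals. *)
Definition trop (R : realType) := option R.

Section Tropical.
Variable R : realType.
Local Notation T := (trop R).

HB.instance Definition _ := Choice.on T.

Definition trop_add (a b : T) : T :=
  match a, b with
  | None, _ => b
  | _, None => a
  | Some x, Some y => Some (Num.max x y)
  end.

Definition trop_mul (a b : T) : T :=
  match a, b with
  | Some x, Some y => Some (x + y)
  | _, _ => None
  end.

Lemma trop_addA : associative trop_add.
Proof. by case=> [x|] [y|] [z|] //=; rewrite maxA. Qed.
Lemma trop_addC : commutative trop_add.
Proof. by case=> [x|] [y|] //=; rewrite maxC. Qed.
Lemma trop_add0 : left_id None trop_add.
Proof. by []. Qed.

HB.instance Definition _ := GRing.isNmodule.Build T
  trop_addA trop_addC trop_add0.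

Lemma trop_mulA : associative trop_mul.
Proof. by case=> [x|] [y|] [z|] //=; rewrite addrA. Qed.
Lemma trop_mulC : commutative trop_mul.
Proof. by case=> [x|] [y|] //=; rewrite addrC. Qed.
Lemma trop_mul1 : left_id (Some 0) trop_mul.
Proof. by case=> [x|] //=; rewrite add0r. Qed.
Lemma trop_mulDl : left_distributive trop_mul trop_add.
Proof. by case=> [x|] [y|] [z|] //=; rewrite addr_maxl. Qed.
Lemma trop_mul0 : left_zero None trop_mul.
Proof. by []. Qed.

HB.instance Definition _ := GRing.Nmodule_isComPzSemiRing.Build T
  trop_mulA trop_mulC trop_mul1 trop_mulDl trop_mul0.

Definition trop_inv (a : T) : T := omap -%R a.

Lemma trop_mulV (a : T) : a != 0 -> a * trop_inv a = 1.
Proof. by case: a => // x _; congr Some; rewrite subrr. Qed.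

Lemma trop_mulf_neq0 (a b : T) : a != 0 -> b != 0 -> a * b != 0.
Proof. by case: a b => [x|] [y|]. Qed.

Lemma trop_invM (a b : T) : trop_inv (a * b) = trop_inv a * trop_inv b.
Proof. by case: a b => [x|] [y|] //; congr Some; rewrite opprD. Qed.

Lemma trop_add_neq0 (a b : T) : a != 0 -> a + b != 0.
Proof. by case: a b => [x|] [y|]. Qed.

Lemma trop_sum_neq0 (I : eqType) (r : seq I) (F : I -> T) (i : I) :
  i \in r -> F i != 0 -> \sum_(j <- r) F j != 0.
Proof.
move=> + Fi; elim: r => //= j r IH; rewrite big_cons inE.
by case/predU1P=> [<-|/IH h]; [|rewrite addrC]; apply: trop_add_neq0.
Qed.

End Tropical.

(* Formal Laurent polynomials T[X^+-]_n: the exponents are the elements of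
   Z^n. *)
Definition laurent (T : comPzSemiRingType) (n : nat) :=
  {fsfun 'rV[int]_n -> T with 0}.

Section Laurent.
Variables (T : comPzSemiRingType) (n : nat).
Local Notation L := (laurent T n).
Local Notation Zn := 'rV[int]_n.
Local Open Scope fset_scope.
Local Open Scope ring_scope.

HB.instance Definition _ := Choice.on L.

Definition laurent_zero : L := [fsfun u in fset0 => 0].

Definition laurent_const (a : T) : L := [fsfun u in [fset (0 : Zn)] => a].

Definition laurent_add (f g : L) : L :=
  [fsfun u in finsupp f `|` finsupp g => f u + g u].

Definition laurent_mul (f g : L) : L :=
  [fsfun w in [fset u + v | u in finsupp f, v in finsupp g] =>
    \sum_(u <- finsupp f) f u * g (w - u)].

(* The T-linear extension of phi from monomials to Laurent polynomials.
   A Laurent polynomial is determined by its pairings (pairing_inj), and the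
   product satisfies pairing_mul, which yields the semiring laws. *)
Definition pairing (f : L) (phi : Zn -> T) : T :=
  \sum_(u <- finsupp f) f u * phi u.

Lemma pairing_sub (A : {fset Zn}) (f : L) phi : finsupp f `<=` A ->
  pairing f phi = \sum_(u <- A) f u * phi u.
Proof.
move=> sA; apply: big_fset_incl => // u _ /fsfun_dflt ->; exact: mul0r.
Qed.

Lemma pairing_delta (f : L) w : pairing f (fun u => (u == w)%:R) = f w.
Proof.
rewrite (@pairing_sub (w |` finsupp f)) ?fsubsetUr //.
rewrite (big_fsetD1 w) ?fset1U1 //= eqxx mulr1 big1_fset ?addr0 // => u.
by rewrite !inE => /andP[/negPf-> _] _; rewrite mulr0.
Qed.

Lemma pairing_inj (f g : L) : pairing f =1 pairing g -> f = g.
Proof. by move=> fg; apply/fsfunP => w; rewrite -!pairing_delta fg. Qed.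

Lemma eq_pairing (f : L) phi psi : phi =1 psi -> pairing f phi = pairing f psi.
Proof. by move=> h; apply: eq_bigr => u _; rewrite h. Qed.

Lemma laurent_addE (f g : L) u : laurent_add f g u = f u + g u.
Proof.
rewrite fsfunE; case: ifPn => //; rewrite inE negb_or => /andP[uf ug].
by rewrite !fsfun_dflt // addr0.
Qed.

Lemma laurent_mulE (f g : L) w :
  laurent_mul f g w = \sum_(u <- finsupp f) f u * g (w - u).
Proof.
rewrite fsfunE; case: ifPn => // wN; rewrite big1_fset // => u uf _.
have [|ug] := boolP (w - u \in finsupp g); last by rewrite (fsfun_dflt ug) mulr0.
by move=> ug; case/negP: wN; apply/imfset2P; exists u => //; exists (w - u);
  rewrite //= addrC subrK.
Qed.

Lemma pairing_zero phi : pairing laurent_zero phi = 0.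
Proof. by rewrite /pairing big1 // => u _; rewrite fsfunE mul0r. Qed.

Lemma pairing_const a phi : pairing (laurent_const a) phi = a * phi 0.
Proof.
rewrite (@pairing_sub [fset 0]); last exact: finsupp_sub.
by rewrite big_seq_fset1 fsfunE inE eqxx.
Qed.

Lemma pairing_add (f g : L) phi :
  pairing (laurent_add f g) phi = pairing f phi + pairing g phi.
Proof.
rewrite !(@pairing_sub (finsupp f `|` finsupp g)) ?fsubsetUl ?fsubsetUr //;
  last exact: finsupp_sub.
by rewrite -big_split; apply: eq_bigr => u _; rewrite laurent_addE mulrDl.
Qed.

Lemma pairing_mul (f g : L) phi :
  pairing (laurent_mul f g) phi =
  pairing f (fun u => pairing g (fun v => phi (u + v))).
Proof.
set A := [fset u + v | u in finsupp f, v in finsupp g].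
rewrite (@pairing_sub A); last exact: finsupp_sub.
under eq_bigr do rewrite laurent_mulE big_distrl /=.
rewrite exchange_big /=; apply: eq_big_seq => u uf.
under eq_bigr do rewrite -mulrA.
rewrite -big_distrr /=; congr (_ * _).
have sub : [fset u + v | v in finsupp g] `<=` A.
  apply/fsubsetP => w /imfsetP[v /= vg ->].
  by apply/imfset2P; exists u => //; exists v.
rewrite -(big_fset_incl _ sub); last first.
  move=> w _ wN; rewrite fsfun_dflt ?mul0r //; apply: contra wN => ug.
  by apply/imfsetP; exists (w - u); rewrite //= addrC subrK.
rewrite big_imfset /=; last by move=> ? ? _ _ /addrI.
by apply: eq_bigr => v _; rewrite addrC addrA [- u + u]addNr add0r addrC.
Qed.

Lemma laurent_addA : associative laurent_add.
Proof. by move=> f g h; apply: pairing_inj => phi; rewrite !pairing_add addrA. Qed.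
Lemma laurent_addC : commutative laurent_add.
Proof. by move=> f g; apply: pairing_inj => phi; rewrite !pairing_add addrC. Qed.
Lemma laurent_add0 : left_id laurent_zero laurent_add.
Proof.
by move=> f; apply: pairing_inj => phi; rewrite pairing_add pairing_zero add0r.
Qed.

HB.instance Definition _ := GRing.isNmodule.Build L
  laurent_addA laurent_addC laurent_add0.

Lemma laurent_mulA : associative laurent_mul.
Proof.
move=> f g h; apply: pairing_inj => phi; rewrite !pairing_mul.
apply: eq_pairing => u; rewrite pairing_mul; apply: eq_pairing => v.
by apply: eq_pairing => w; rewrite addrA.
Qed.

Lemma laurent_mulC : commutative laurent_mul.
Proof.
move=> f g; apply: pairing_inj => phi; rewrite !pairing_mul /pairing.
under eq_bigr do rewrite big_distrr /=.
rewrite exchange_big /=; apply: eq_bigr => v _; rewrite big_distrr /=.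
by apply: eq_bigr => u _; rewrite mulrCA addrC.
Qed.

Lemma laurent_mul1 : left_id (laurent_const 1) laurent_mul.
Proof.
move=> f; apply: pairing_inj => phi; rewrite pairing_mul pairing_const mul1r.
by apply: eq_pairing => v; rewrite add0r.
Qed.

Lemma laurent_mulDl : left_distributive laurent_mul laurent_add.
Proof.
by move=> f g h; apply: pairing_inj => phi; rewrite !(pairing_mul, pairing_add).
Qed.

Lemma laurent_mul0 : left_zero laurent_zero laurent_mul.
Proof.
by move=> f; apply: pairing_inj => phi; rewrite pairing_mul !pairing_zero.
Qed.

HB.instance Definition _ := GRing.Nmodule_isComPzSemiRing.Build L
  laurent_mulA laurent_mulC laurent_mul1 laurent_mulDl laurent_mul0.

Lemma laurent_const_nmod : nmod_morphism laurent_const.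
Proof.
split; first by apply: pairing_inj => phi; rewrite pairing_const pairing_zero mul0r.
move=> a b; apply: pairing_inj => phi.
by rewrite [RHS]pairing_add !pairing_const mulrDl.
Qed.

Lemma laurent_const_monoid : monoid_morphism laurent_const.
Proof.
split=> // a b; apply: pairing_inj => phi.
by rewrite [RHS]pairing_mul !pairing_const addr0 mulrA.
Qed.

HB.instance Definition _ :=
  GRing.isNmodMorphism.Build T L laurent_const laurent_const_nmod.
HB.instance Definition _ :=
  GRing.isMonoidMorphism.Build T L laurent_const laurent_const_monoid.
HB.instance Definition _ :=
  hasStructMap.Build T L (laurent_const : {rmorphism T -> L}).

End Laurent.

HB.mixin Record isCancellative S of GRing.ComNzSemiRing S := {
  mul_cancel : forall a b c : S, c != 0 -> a * c = b * c -> a = b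
}.

#[short(type="cancellativeSemiRingType")]
HB.structure Definition CancellativeSemiRing :=
  {S of GRing.ComNzSemiRing S & isCancellative S}.

(* The semiring of fractions of a cancellative semiring S: pairs (a, b) with
   b != 0, modulo (a, b) ~ (c, d) iff a * d = c * b. *)
Section Fractions.
Variable S : cancellativeSemiRingType.

Lemma canc_mulf_neq0 (a b : S) : a != 0 -> b != 0 -> a * b != 0.
Proof.
move=> a0 b0; apply: contraNneq a0 => ab0.
by apply/eqP; apply: (mul_cancel _ _ _ b0); rewrite ab0 mul0r.
Qed.

Definition fpair := {p : S * S | p.2 != 0}.
HB.instance Definition _ := Choice.on fpair.

Definition fnum (p : fpair) : S := (val p).1.
Definition fden (p : fpair) : S := (val p).2.
Lemma fden_neq0 p : fden p != 0. Proof. exact: valP p. Qed.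

Definition mkfpair (a b : S) (b0 : b != 0) : fpair := exist _ (a, b) b0.

Definition frac_rel : rel fpair := fun p q => fnum p * fden q == fnum q * fden p.

Lemma frac_rel_equiv : equiv_class_of frac_rel.
Proof.
split=> [p|p q|q p r]; rewrite /frac_rel; first exact: eqxx.
  exact: eq_sym.
move=> /eqP pq /eqP qr; apply/eqP/(mul_cancel _ _ _ (fden_neq0 q)).
by rewrite mulrAC pq mulrAC qr mulrAC.
Qed.

Canonical frac_equiv := EquivRelPack frac_rel_equiv.

Definition frac := {eq_quot frac_equiv}.
HB.instance Definition _ := Choice.on frac.
HB.instance Definition _ := EqQuotient.on frac.

Lemma fracP (p q : fpair) :
  \pi_frac p = \pi_frac q <-> fnum p * fden q = fnum q * fden p.
Proof. by split=> [/eqquotP/eqP //|h]; apply/eqquotP/eqP. Qed.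

Lemma frac_repr p : fnum (repr (\pi_frac p)) * fden p
  = fnum p * fden (repr (\pi_frac p)).
Proof. by apply/fracP; rewrite reprK. Qed.

Definition fpair_const (a : S) : fpair := mkfpair a (oner_neq0 S).

Definition fpair_add (p q : fpair) : fpair :=
  mkfpair (fnum p * fden q + fnum q * fden p)
    (canc_mulf_neq0 (fden_neq0 p) (fden_neq0 q)).

Definition fpair_mul (p q : fpair) : fpair :=
  mkfpair (fnum p * fnum q) (canc_mulf_neq0 (fden_neq0 p) (fden_neq0 q)).

Definition frac_inj (a : S) : frac := \pi_frac (fpair_const a).
Definition frac_add (x y : frac) : frac := \pi_frac (fpair_add (repr x) (repr y)).
Definition frac_mul (x y : frac) : frac := \pi_frac (fpair_mul (repr x) (repr y)).

Lemma frac_addE p q :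
  frac_add (\pi_frac p) (\pi_frac q) = \pi_frac (fpair_add p q).
Proof.
apply/fracP; have := frac_repr p; have := frac_repr q.
move: (repr (\pi_frac p)) (repr (\pi_frac q)) => p' q' hq hp.
change ((fnum p' * fden q' + fnum q' * fden p') * (fden p * fden q) =
  (fnum p * fden q + fnum q * fden p) * (fden p' * fden q')).
have -> : (fnum p' * fden q' + fnum q' * fden p') * (fden p * fden q) =
  (fnum p' * fden p) * (fden q' * fden q) +
  (fnum q' * fden q) * (fden p' * fden p) by ring.
by rewrite hp hq; ring.
Qed.

Lemma frac_mulE p q :
  frac_mul (\pi_frac p) (\pi_frac q) = \pi_frac (fpair_mul p q).
Proof.
apply/fracP; have := frac_repr p; have := frac_repr q.
move: (repr (\pi_frac p)) (repr (\pi_frac q)) => p' q' hq hp.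
change ((fnum p' * fnum q') * (fden p * fden q) =
  (fnum p * fnum q) * (fden p' * fden q')).
by rewrite mulrACA hp hq mulrACA.
Qed.

Lemma fpair_eq p q : fnum p = fnum q -> fden p = fden q -> p = q.
Proof.
by case: p q => [[a b] b0] [[c d] d0]; rewrite /fnum /fden /= => ac bd;
  apply/val_inj; rewrite /= ac bd.
Qed.

Lemma fpair_addA : associative fpair_add.
Proof.
move=> p q r; apply: fpair_eq; rewrite /fpair_add /fnum /fden /=; last exact: mulrA.
ring.
Qed.

Lemma fpair_mulA : associative fpair_mul.
Proof. by move=> p q r; apply: fpair_eq; apply: mulrA. Qed.

Lemma frac_addA : associative frac_add.
Proof.
move=> x y z; elim/quotW: x => p; elim/quotW: y => q; elim/quotW: z => r.
by rewrite (frac_addE p q) (frac_addE q r) !frac_addE fpair_addA.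
Qed.

Lemma frac_addC : commutative frac_add.
Proof.
move=> x y; congr (\pi_frac _); apply: fpair_eq; first exact: addrC.
exact: mulrC.
Qed.

Lemma frac_add0 : left_id (frac_inj 0) frac_add.
Proof.
move=> x; elim/quotW: x => p; rewrite frac_addE; congr (\pi_frac _).
by apply: fpair_eq; [rewrite /fnum /fden /= mul0r add0r mulr1 | apply: mul1r].
Qed.

HB.instance Definition _ := GRing.isNmodule.Build frac
  frac_addA frac_addC frac_add0.

Lemma frac_mulA : associative frac_mul.
Proof.
move=> x y z; elim/quotW: x => p; elim/quotW: y => q; elim/quotW: z => r.
by rewrite (frac_mulE p q) (frac_mulE q r) !frac_mulE fpair_mulA.
Qed.

Lemma frac_mulC : commutative frac_mul.
Proof. by move=> x y; congr (\pi_frac _); apply: fpair_eq; apply: mulrC. Qed.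

Lemma frac_mul1 : left_id (frac_inj 1) frac_mul.
Proof.
move=> x; elim/quotW: x => p; rewrite frac_mulE; congr (\pi_frac _).
by apply: fpair_eq; apply: mul1r.
Qed.

Lemma frac_mulDl : left_distributive frac_mul frac_add.
Proof.
move=> x y z; elim/quotW: x => p; elim/quotW: y => q; elim/quotW: z => r.
rewrite (frac_addE p q) (frac_mulE p r) (frac_mulE q r) frac_mulE frac_addE.
apply/fracP; rewrite /fpair_add /fpair_mul /fnum /fden /=; ring.
Qed.

Lemma frac_mul0 : left_zero (frac_inj 0) frac_mul.
Proof.
move=> x; elim/quotW: x => p; rewrite frac_mulE.
by apply/fracP; rewrite /fpair_mul /fnum /fden /= !mul0r.
Qed.

HB.instance Definition _ := GRing.Nmodule_isComPzSemiRing.Build frac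
  frac_mulA frac_mulC frac_mul1 frac_mulDl frac_mul0.

Lemma frac_inj_nmod : nmod_morphism frac_inj.
Proof.
split=> // a b; rewrite [RHS](frac_addE (fpair_const a) (fpair_const b)).
by congr (\pi_frac _); apply: fpair_eq;
  rewrite /fpair_add /fnum /fden /= ?mulr1.
Qed.

Lemma frac_inj_monoid : monoid_morphism frac_inj.
Proof.
split=> // a b; rewrite [RHS](frac_mulE (fpair_const a) (fpair_const b)).
by congr (\pi_frac _); apply: fpair_eq;
  rewrite /fpair_mul /fnum /fden /= ?mulr1.
Qed.

HB.instance Definition _ := GRing.isNmodMorphism.Build S frac
  frac_inj frac_inj_nmod.
HB.instance Definition _ := GRing.isMonoidMorphism.Build S frac
  frac_inj frac_inj_monoid.

Lemma frac_semifield (x : frac) : x != 0 -> exists y, x * y = 1.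
Proof.
elim/quotW: x => p p0; have a0 : fnum p != 0.
  by apply: contraNneq p0 => a0; apply/eqP/fracP; rewrite a0 !mul0r.
exists (\pi_frac (mkfpair (fden p) a0)); rewrite [LHS]frac_mulE.
by apply/fracP; rewrite /fpair_mul /fnum /fden /= mulr1 mul1r mulrC.
Qed.

End Fractions.

(* The congruence E(V) for a semiring L of functions on R^n; ev x f is f(x). *)
Section VanishingCongruence.
Variables (R : realType) (n : nat) (L : comPzSemiRingType).
Variable ev : 'rV[R]_n -> {rmorphism L -> trop R}.
Variable V : set 'rV[R]_n.

Lemma E_is_congruence :
  is_congruence [set p : L * L | forall x, V x -> ev x p.1 = ev x p.2].
Proof.
split=> //=.
- by move=> a b h x Vx; rewrite h.
- by move=> a b c h k x Vx; rewrite h ?k.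
- by move=> a b c d h k x Vx; rewrite !rmorphD h ?k.
- by move=> a b c d h k x Vx; rewrite !rmorphM h ?k.
Qed.

Definition E : congruence L := Congruence E_is_congruence.

End VanishingCongruence.

Section LaurentFunctions.
Variables (R : realType) (n : nat).
Local Notation T := (trop R).
Local Notation L := (laurent T n).

Definition monomial_eval (x : 'rV[R]_n) (u : 'rV[int]_n) : T :=
  Some (\sum_(i < n) (u ord0 i)%:~R * x ord0 i).

Lemma monomial_evalD x u v :
  monomial_eval x (u + v) = monomial_eval x u * monomial_eval x v.
Proof.
congr Some; rewrite -big_split; apply: eq_bigr => i _.
by rewrite mxE rmorphD mulrDl.
Qed.

Lemma monomial_eval0 x : monomial_eval x 0 = 1.
Proof. by congr Some; apply: big1 => i _; rewrite mxE mul0r. Qed.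

Definition laurent_eval_fun (x : 'rV[R]_n) (f : L) : T :=
  \sum_(u <- finsupp f) f u * monomial_eval x u.

Section Morphism.
Variable x : 'rV[R]_n.

Lemma laurent_eval_nmod : nmod_morphism (laurent_eval_fun x).
Proof. by split=> [|f g]; [apply: pairing_zero | apply: pairing_add]. Qed.

Lemma laurent_eval_monoid : monoid_morphism (laurent_eval_fun x).
Proof.
split=> [|f g].
  by rewrite [LHS]pairing_const monomial_eval0 mulr1.
rewrite [LHS]pairing_mul [in RHS]/laurent_eval_fun big_distrl /=.
apply: eq_bigr => u _; rewrite -mulrA; congr (_ * _).
rewrite /laurent_eval_fun big_distrr /=.
by apply: eq_bigr => v _; rewrite monomial_evalD mulrCA.
Qed.

HB.instance Definition _ := GRing.isNmodMorphism.Build L T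
  (laurent_eval_fun x) laurent_eval_nmod.
HB.instance Definition _ := GRing.isMonoidMorphism.Build L T
  (laurent_eval_fun x) laurent_eval_monoid.

Definition laurent_eval : {rmorphism L -> T} := laurent_eval_fun x.

End Morphism.

Lemma laurent_eval_neq0 (f : L) x : f != 0 -> laurent_eval x f != 0.
Proof.
move=> f0; have [u fu] : exists u, u \in finsupp f.
  apply: contrapT => /forallNP h; case/eqP: f0; apply/fsfunP => u.
  by rewrite fsfunE fsfun_dflt //; apply/negP/h.
apply: (trop_sum_neq0 fu); apply: trop_mulf_neq0 => //.
by move: fu; rewrite mem_finsupp.
Qed.

(* Laurent polynomials up to equality as functions on R^n. *)
Definition laurent_fun := squot (E laurent_eval [set: 'rV[R]_n]).

HB.instance Definition _ := SemiringAlg.on laurent_fun.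

Definition laurent_fun_eval_fun (x : 'rV[R]_n) (f : laurent_fun) : T :=
  laurent_eval x (repr f).

Lemma laurent_fun_evalE x (f : L) :
  laurent_fun_eval_fun x (squot_pi _ f) = laurent_eval x f.
Proof. exact: (@squot_repr L (E laurent_eval setT)). Qed.

Lemma laurent_funW (P : laurent_fun -> Prop) :
  (forall f, P (squot_pi _ f)) -> forall f, P f.
Proof. by move=> h; elim/quotW => f; apply: h. Qed.

Lemma laurent_funP (f g : laurent_fun) :
  (forall x, laurent_fun_eval_fun x f = laurent_fun_eval_fun x g) -> f = g.
Proof.
elim/laurent_funW: f => f; elim/laurent_funW: g => g h.
by apply/squotP => x _; rewrite -!laurent_fun_evalE.
Qed.

Section Morphism.
Variable x : 'rV[R]_n.

Lemma laurent_fun_eval_nmod : nmod_morphism (laurent_fun_eval_fun x).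
Proof.
split; first by rewrite -(rmorph0 (squot_pi _)) laurent_fun_evalE rmorph0.
move=> f g; elim/laurent_funW: f => f; elim/laurent_funW: g => g.
by rewrite -rmorphD !laurent_fun_evalE rmorphD.
Qed.

Lemma laurent_fun_eval_monoid : monoid_morphism (laurent_fun_eval_fun x).
Proof.
split; first by rewrite -(rmorph1 (squot_pi _)) laurent_fun_evalE rmorph1.
move=> f g; elim/laurent_funW: f => f; elim/laurent_funW: g => g.
by rewrite -rmorphM !laurent_fun_evalE rmorphM.
Qed.

HB.instance Definition _ := GRing.isNmodMorphism.Build laurent_fun T
  (laurent_fun_eval_fun x) laurent_fun_eval_nmod.
HB.instance Definition _ := GRing.isMonoidMorphism.Build laurent_fun T
  (laurent_fun_eval_fun x) laurent_fun_eval_monoid.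

Definition laurent_fun_eval : {rmorphism laurent_fun -> T} :=
  laurent_fun_eval_fun x.

End Morphism.

Lemma laurent_fun_eval_neq0 (f : laurent_fun) x :
  f != 0 -> laurent_fun_eval x f != 0.
Proof.
elim/laurent_funW: f => f h; rewrite /= laurent_fun_evalE.
by apply: laurent_eval_neq0; apply: contraNneq h => ->; rewrite rmorph0.
Qed.

Lemma laurent_fun_neq0 : (1 : laurent_fun) != 0.
Proof.
apply/eqP => /(congr1 (laurent_fun_eval 0)).
by rewrite rmorph1 rmorph0.
Qed.

Lemma laurent_fun_cancel (a b c : laurent_fun) :
  c != 0 -> a * c = b * c -> a = b.
Proof.
move=> c0 ac; apply: laurent_funP => x.
have cx := laurent_fun_eval_neq0 x c0.
rewrite -[LHS]mulr1 -[RHS]mulr1 -(trop_mulV cx) !mulrA.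
by have /= := congr1 (laurent_fun_eval x) ac; rewrite !rmorphM /= => ->.
Qed.

HB.instance Definition _ :=
  GRing.PzSemiRing_isNonZero.Build laurent_fun laurent_fun_neq0.
HB.instance Definition _ := isCancellative.Build laurent_fun laurent_fun_cancel.

Definition rational_fun := frac laurent_fun.

HB.instance Definition _ := GRing.ComPzSemiRing.on rational_fun.
HB.instance Definition _ := hasStructMap.Build T rational_fun
  (@frac_inj laurent_fun \o (structmap : {rmorphism T -> laurent_fun})).

Definition fpair_eval (x : 'rV[R]_n) (p : fpair laurent_fun) : T :=
  laurent_fun_eval x (fnum p) * trop_inv (laurent_fun_eval x (fden p)).

Definition rational_fun_eval_fun (x : 'rV[R]_n) (f : rational_fun) : T :=
  fpair_eval x (repr f).

Lemma fpair_evalE x p : rational_fun_eval_fun x (\pi_(frac laurent_fun) p) =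
  fpair_eval x p.
Proof.
rewrite /rational_fun_eval_fun /fpair_eval.
have /(congr1 (laurent_fun_eval x)) := frac_repr p; rewrite !rmorphM.
move: (repr _) => q h.
have p0 := trop_mulV (laurent_fun_eval_neq0 x (fden_neq0 p)).
have q0 := trop_mulV (laurent_fun_eval_neq0 x (fden_neq0 q)).
rewrite -[LHS]mulr1 -p0 -[RHS]mulr1 -q0 mulrACA h mulrACA [RHS]mulrACA.
by rewrite [LHS]mulrACA; congr (_ * _); exact: mulrC.
Qed.

Section Morphism.
Variable x : 'rV[R]_n.
Local Notation ev := (laurent_fun_eval x).

Lemma rational_fun_eval_inj (f : laurent_fun) :
  rational_fun_eval_fun x (frac_inj f) = ev f.
Proof.
rewrite fpair_evalE /fpair_eval /fnum /fden /= -/ev rmorph1.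
by rewrite -[trop_inv 1]mul1r trop_mulV ?mulr1.
Qed.

Lemma rational_fun_eval_nmod : nmod_morphism (rational_fun_eval_fun x).
Proof.
split; first by rewrite [LHS]rational_fun_eval_inj rmorph0.
move=> f g; elim/quotW: f => p; elim/quotW: g => q.
rewrite [X in rational_fun_eval_fun x X]frac_addE !fpair_evalE /fpair_eval.
rewrite /fpair_add {1}/fnum {1}/fden /= -/ev !rmorphD !rmorphM trop_invM.
have p0 := trop_mulV (laurent_fun_eval_neq0 x (fden_neq0 p)).
have q0 := trop_mulV (laurent_fun_eval_neq0 x (fden_neq0 q)).
rewrite mulrDl; congr (_ + _); first by rewrite mulrACA q0 mulr1.
by rewrite [trop_inv _ * _]mulrC mulrACA p0 mulr1.
Qed.

Lemma rational_fun_eval_monoid : monoid_morphism (rational_fun_eval_fun x).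
Proof.
split; first by rewrite [LHS]rational_fun_eval_inj rmorph1.
move=> f g; elim/quotW: f => p; elim/quotW: g => q.
rewrite [X in rational_fun_eval_fun x X]frac_mulE !fpair_evalE /fpair_eval.
rewrite /fpair_mul {1}/fnum {1}/fden /= -/ev !rmorphM trop_invM.
exact: mulrACA.
Qed.

HB.instance Definition _ := GRing.isNmodMorphism.Build rational_fun T
  (rational_fun_eval_fun x) rational_fun_eval_nmod.
HB.instance Definition _ := GRing.isMonoidMorphism.Build rational_fun T
  (rational_fun_eval_fun x) rational_fun_eval_monoid.

Definition rational_fun_eval : {rmorphism rational_fun -> T} :=
  rational_fun_eval_fun x.

End Morphism.

End LaurentFunctions.

(* Main.v *)
From HB Require Import structures.
Require Import Defs.
From mathcomp Require Import all_boot all_order all_algebra.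
From mathcomp Require Import classical_sets reals.
From mathcomp Require Import finmap boolp topology lra.

(** For each of the three semirings K = L/E(V) with V nonempty, CSpec(K) is a
local space: it has a point whose only neighbourhood is the whole space, so
that global sections are determined by what they are near that point.

Every nonzero element f of K dominates a unit u, in the sense that u + f = f:
a nonzero tropical Laurent polynomial is the maximum of its monomials, each
of which is invertible, and in a semifield f is itself a unit.  Hence a proper
congruence P never identifies a nonzero f with 0: it would also identify u
with 0, because u = u + 0 ~ u + f = f ~ 0, and then everything collapses.  So
every prime congruence lies below the one that only records whether an element
is zero ([prime_sub_support]).  That largest congruence is itself prime as soon
as K has a homomorphism to T, being the kernel of K -> T -> {-oo, 0}; it is a
point whose only neighbourhood is the whole of CSpec(K)
([nbhs_largest]).  A global section is induced by a single element of K
near that point, hence everywhere: this is surjectivity of the canonical map.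

For injectivity, T is totally ordered and cancellative, so the kernel of every
homomorphism K -> T is prime ([trop_prime], [ker_prime]).  Evaluations at the
points of V are such homomorphisms, and by definition of E(V) they separate
the elements of K.

If V is empty, then K is the zero semiring and CSpec(K) is empty. *)

Set Implicit Arguments.
Unset Strict Implicit.
Unset Printing Implicit Defensive.

Import Order.TTheory GRing.Theory Num.Theory.
Local Open Scope ring_scope.
Local Open Scope classical_set_scope.

(** * Homomorphisms to the tropical semifield and prime congruences *)

Section Kernel.
Variables (S A : comPzSemiRingType) (phi : {rmorphism S -> A}).

Lemma ker_is_congruence : is_congruence [set p : S * S | phi p.1 = phi p.2].
Proof.
split=> //=.
- by move=> a b c -> ->.
- by move=> a b c d h k; rewrite !rmorphD h k.
- by move=> a b c d h k; rewrite !rmorphM h k.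
Qed.

Definition ker_congruence := Congruence ker_is_congruence.

End Kernel.

Section Lift.
Variables (S A : comPzSemiRingType) (C : congruence S).
Variables (phi : {rmorphism S -> A}) (sub : C `<=` ker_congruence phi).

Definition squot_lift_fun (x : squot C) : A := phi (repr x).

Lemma squot_lift_funE a : squot_lift_fun (squot_pi C a) = phi a.
Proof. exact: (sub (squot_repr C a)). Qed.

Lemma squot_lift_nmod : nmod_morphism squot_lift_fun.
Proof.
split; first by rewrite -(rmorph0 (squot_pi C)) squot_lift_funE rmorph0.
elim/quotW=> a; elim/quotW=> b.
by rewrite -[X in squot_lift_fun X](rmorphD (squot_pi C)) !squot_lift_funE rmorphD.
Qed.

Lemma squot_lift_monoid : monoid_morphism squot_lift_fun.
Proof.
split; first by rewrite -(rmorph1 (squot_pi C)) squot_lift_funE rmorph1.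
elim/quotW=> a; elim/quotW=> b.
by rewrite -[X in squot_lift_fun X](rmorphM (squot_pi C)) !squot_lift_funE rmorphM.
Qed.

HB.instance Definition _ := GRing.isNmodMorphism.Build (squot C) A
  squot_lift_fun squot_lift_nmod.
HB.instance Definition _ := GRing.isMonoidMorphism.Build (squot C) A
  squot_lift_fun squot_lift_monoid.

Definition squot_lift : {rmorphism squot C -> A} := squot_lift_fun.

Lemma squot_liftE a : squot_lift (squot_pi C a) = phi a.
Proof. exact: squot_lift_funE. Qed.

End Lift.

Section TropicalKernel.
Variable R : realType.
Local Notation T := (trop R).

(** If a < b and c < d, then b + d strictly exceeds both a + d and b + c, so
the two sides differ; the three other strict configurations are symmetric. *)
Lemma max_add_prime (a b c d : R) :
  Num.max (a + c) (b + d) = Num.max (a + d) (b + c) -> a = b \/ c = d.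
Proof.
have [ab|ba|->] := ltgtP a b; last by left.
  have [cd|dc|->] := ltgtP c d; last by right.
    by rewrite !maxEle; do 2 case: ifP; lra.
  by rewrite !maxEle; do 2 case: ifP; lra.
have [cd|dc|->] := ltgtP c d; last by right.
  by rewrite !maxEle; do 2 case: ifP; lra.
by rewrite !maxEle; do 2 case: ifP; lra.
Qed.

Lemma trop_prime (a b c d : T) :
  a * c + b * d = a * d + b * c -> a = b \/ c = d.
Proof.
have mulI (x y z : T) : x != 0 -> x * y = x * z -> y = z.
  by case: x y z => [x|] [y|] [z|] // _ [] /addrI->.
have [->|a0] := eqVneq a 0.
  have [->|b0] := eqVneq b 0; first by left.
  by rewrite !mul0r !add0r => /(mulI _ _ _ b0)->; right.
have [->|b0] := eqVneq b 0.
  by rewrite !mul0r !addr0 => /(mulI _ _ _ a0)->; right.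
case: a b a0 b0 => [a|] [b|] // _ _.
case: c d => [c|] [d|]; last by right.
- by case=> /max_add_prime[]->; [left | right].
- by move=> [] /addIr ->; left.
- by move=> [] /addIr ->; left.
Qed.

Lemma ker_prime (S : comPzSemiRingType) (phi : {rmorphism S -> T}) :
  is_prime (ker_congruence phi).
Proof.
split=> [h|a b c d /=].
  have : congruence_set (ker_congruence phi) (1, 0) by rewrite h.
  by rewrite /= rmorph1 rmorph0.
by rewrite !(rmorphD, rmorphM) => /trop_prime.
Qed.

Definition ker_point (S : comPzSemiRingType) (phi : {rmorphism S -> T}) :
  CSpec S := PrimeCongruence (ker_prime phi).

(** The retraction of T onto its Boolean subsemifield {-oo, 0}. *)
Definition trop_support (a : T) : T := if a is Some _ then Some 0 else None.

Lemma trop_support_nmod : nmod_morphism trop_support.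
Proof. by split=> [|[x|] [y|]] //; congr Some; rewrite maxxx. Qed.

Lemma trop_support_monoid : monoid_morphism trop_support.
Proof. by split=> [|[x|] [y|]] //; congr Some; rewrite addr0. Qed.

HB.instance Definition _ := GRing.isNmodMorphism.Build T T
  trop_support trop_support_nmod.
HB.instance Definition _ := GRing.isMonoidMorphism.Build T T
  trop_support trop_support_monoid.

Lemma trop_support_neq0 (a b : T) :
  a != 0 -> b != 0 -> trop_support a = trop_support b.
Proof. by case: a b => [x|] [y|]. Qed.

Lemma trop_addrr (a : T) : a + a = a.
Proof. by case: a => [x|] //; congr Some; rewrite maxxx. Qed.

Lemma tropalg_addrr (A : semiringAlgType T) (x : A) : x + x = x.
Proof.
rewrite -[x in x + x]mul1r -mulrDl -(rmorph1 (structmap : {rmorphism T -> A})).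
by rewrite -rmorphD trop_addrr rmorph1 mul1r.
Qed.

End TropicalKernel.

(** * Semirings whose nonzero elements dominate units *)

(** In an idempotent semiring, u + f = f says that u <= f. *)
Definition unit_dominating (S : comPzSemiRingType) :=
  forall f : S, f != 0 -> exists u v, u * v = 1 /\ u + f = f.

Lemma unit_dominating_squot (S : comPzSemiRingType) (C : congruence S) :
  unit_dominating S -> unit_dominating (squot C).
Proof.
move=> dom; elim/quotW=> f f0.
have [|u [v [uv uf]]] := dom f.
  by apply: contraNneq f0 => ->; apply/eqP.
exists (squot_pi C u), (squot_pi C v).
rewrite -rmorphM uv rmorph1; split=> //.
by rewrite -[X in _ + X]/(squot_pi C f) -rmorphD uf.
Qed.

Section LargestPoint.
Variables (R : realType) (S : comPzSemiRingType).
Variable phi : {rmorphism S -> trop R}.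
Hypothesis dom : unit_dominating S.

Lemma unit_dominating_morph_neq0 f : f != 0 -> phi f != 0.
Proof.
move=> /dom[u [v [uv uf]]]; apply/eqP => phif.
have := congr1 phi uf; rewrite rmorphD phif addr0 => phiu.
by have := congr1 phi uv; rewrite rmorphM phiu mul0r rmorph1.
Qed.

(** If P identifies a nonzero f with 0, then it also identifies with 0 a unit u
below f, because u = u + 0 ~ u + f = f ~ 0, and so it is the total congruence. *)
Lemma prime_zero (P : CSpec S) f : congruence_set P (0, f) -> f = 0.
Proof.
have [rfl sm tr ad ml] := congruenceP P.
move=> P0f; apply/eqP; apply: contrapT => /negP /dom[u [v [uv uf]]].
have [] := cspec_prime P; case.
have Pu0 : congruence_set P (u, 0).
  apply: tr (sm _ _ P0f).
  by have := ad _ _ _ _ (rfl u) P0f; rewrite addr0 uf.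
have P10 : congruence_set P (1, 0).
  by have := ml _ _ _ _ Pu0 (rfl v); rewrite uv mul0r.
have Pz a : congruence_set P (a, 0).
  by have := ml _ _ _ _ P10 (rfl a); rewrite mul1r mul0r.
apply/seteqP; split=> // -[a b] _.
exact: tr (Pz a) (sm _ _ (Pz b)).
Qed.

(** By [unit_dominating_morph_neq0] this congruence is the same for every phi:
it only records which elements are zero. *)
Definition support_point : CSpec S :=
  ker_point (@trop_support R \o phi : {rmorphism S -> trop R}).

Lemma prime_sub_support (P : CSpec S) : P `<=` support_point.
Proof.
have [_ sm _ _ _] := congruenceP P.
move=> [a b] /=; have [->|a0] := eqVneq a 0; first by move=> /prime_zero ->.
have [->|b0] := eqVneq b 0; first by move=> /sm /prime_zero ->.
by move=> _; apply: trop_support_neq0; apply: unit_dominating_morph_neq0.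
Qed.

End LargestPoint.

(** Closed sets are upward closed under inclusion of congruences, so an open
set that contains P contains every point below P. *)
Lemma nbhs_largest (S : comPzSemiRingType) (P : CSpec S)
    (W : set (CSpec S)) :
  (forall Q : CSpec S, Q `<=` P) -> nbhs P W -> W = setT.
Proof.
move=> top; rewrite nbhsE => -[U [[C ->] PC] UW].
apply/seteqP; split=> // Q _; apply: UW => CQ; apply: PC.
exact: subset_trans CQ (top Q).
Qed.

Definition global_point (S : comPzSemiRingType) (P : CSpec S) :
  open_setT (CSpec S) := exist _ P (mem_set I).

(** The second hypothesis serves twice.  Kernels of homomorphisms to T are
primes, so it gives injectivity; and if there are no such homomorphisms, it
makes S the zero semiring, whose spectrum is empty. *)
Lemma eta_alg_iso (R : realType) (S : semiringAlgType (trop R)) :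
    unit_dominating S ->
    (forall f g : S,
      (forall phi : {rmorphism S -> trop R}, phi f = phi g) -> f = g) ->
  is_alg_iso (T := trop R) (@eta S).
Proof.
move=> dom sep; split=> //.
- exact: (canonical_section_nmod (open_setT (CSpec S))).
- exact: (canonical_section_monoid (open_setT (CSpec S))).
have eta_inj : injective (@eta S).
  move=> f g fg; apply: sep => phi.
  have /squotP := congr1 (fun s : global_sections S =>
    s (global_point (ker_point phi))) fg.
  exact.
have eta_surj (s : global_sections S) : exists f, eta f = s.
  have [[phi _]|/forallNP no_phi] :=
    pselect (exists phi : {rmorphism S -> trop R}, True).
    have [f [W [PW _ sW]]] := sectionP s (global_point (support_point phi)).
    have WT := nbhs_largest (prime_sub_support phi dom) PW.
    by exists f; apply: section_eq => Q; apply/esym/sW; rewrite WT.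
  exists 0; apply: section_eq => Q; case: (cspec_prime (val Q)) => + _; case.
  have S0 (f : S) : f = 0 by apply: sep => phi; case: (no_phi phi).
  apply/seteqP; split=> // -[a b] _; rewrite (S0 a) (S0 b).
  exact: congruence_refl (congruenceP (val Q)) 0.
have [g etaK] := choice eta_surj.
by exists g => //; apply: inj_can_sym.
Qed.

(** * Tropical Laurent polynomials *)

Section Laurent.
Variables (T : comPzSemiRingType) (n : nat).
Local Notation L := (laurent T n).
Local Open Scope fset_scope.
Local Open Scope ring_scope.

Definition laurent_monomial (a : T) (w : 'rV[int]_n) : L :=
  [fsfun u in [fset w] => a].

Lemma pairing_monomial a w phi : pairing (laurent_monomial a w) phi = a * phi w.
Proof.
rewrite (@pairing_sub _ _ [fset w]); last exact: finsupp_sub.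
by rewrite big_seq_fset1 fsfunE inE eqxx.
Qed.

Lemma laurent_monomialM a b v w :
  laurent_monomial a v * laurent_monomial b w = laurent_monomial (a * b) (v + w).
Proof.
apply: pairing_inj => phi.
by rewrite [LHS]pairing_mul !pairing_monomial mulrA.
Qed.

End Laurent.

Section UnitDominating.
Variables (R : realType) (n : nat).
Local Notation T := (trop R).

Lemma laurent_unit_dominating : unit_dominating (laurent T n).
Proof.
move=> f f0.
have [w fw] : exists w, f w != 0.
  apply: contrapT => /forallNP h; case/eqP: f0; apply/fsfunP => w.
  by rewrite fsfunE; apply/eqP/negPn/negP/h.
(* Any term of f will do: it is a unit, and f is the maximum of its terms. *)
exists (laurent_monomial (f w) w), (laurent_monomial (trop_inv (f w)) (- w)).
split; first by rewrite laurent_monomialM subrr trop_mulV.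
apply/fsfunP => u; rewrite [LHS]laurent_addE fsfunE inE.
have [->|_] := eqVneq u w; last by rewrite add0r.
exact: trop_addrr.
Qed.

(** In an idempotent semifield a nonzero element dominates itself. *)
Lemma rational_fun_unit_dominating : unit_dominating (rational_fun R n).
Proof.
move=> f /frac_semifield[g fg]; exists f, g; split=> //; exact: tropalg_addrr.
Qed.

End UnitDominating.

(** Evaluation at a point of V factors through the quotient by E(V), and these
evaluations separate the classes by the definition of E(V). *)
Lemma eta_vanishing_alg_iso (R : realType) (n : nat)
    (L : semiringAlgType (trop R)) (ev : 'rV[R]_n -> {rmorphism L -> trop R})
    (V : set 'rV[R]_n) :
  unit_dominating L -> is_alg_iso (T := trop R) (@eta (squot (E ev V))).
Proof.
move=> dom; apply: eta_alg_iso; first exact: unit_dominating_squot.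
elim/quotW=> f; elim/quotW=> g h; apply/squotP => x Vx /=.
have sub : E ev V `<=` ker_congruence (ev x) by move=> p; apply.
by have := h (squot_lift sub); rewrite !squot_liftE.
Qed.

Theorem theorem3p8 (R : realType) (n : nat) (V : set 'rV[R]_n) :
  [/\ is_alg_iso (T := trop R)
        (@eta (squot (E (@laurent_eval R n) V))),
      is_alg_iso (T := trop R)
        (@eta (squot (E (@laurent_fun_eval R n) V))) &
      is_alg_iso (T := trop R)
        (@eta (squot (E (@rational_fun_eval R n) V)))].
Proof.
split; apply: eta_vanishing_alg_iso.
- exact: laurent_unit_dominating.
- exact/unit_dominating_squot/laurent_unit_dominating.
- exact: rational_fun_unit_dominating.
Qed.
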